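(* Let $M$ be an $n\times m$ matrix of non-negative integers. Then for all $\mathbf a\in\mathbb N^n$, $$\nu^*_{\mathbf a}(M)<\nu_{\mathbf a}(M)+\min\{m,n\}.$$
   Context: $\mathbb N$ denotes the set of natural numbers including $0$, $\mathbb R_{\ge0}$ the set of non-negative real numbers, $\mathbf 1^m=(1,\dots,1)\in\mathbb N^m$, and vector inequalities are coordinatewise. For $\mathbf a\in\mathbb N^n$, $\nu_{\mathbf a}(M)$ denotes the optimal value of the integer programming problem of maximizing $\mathbf 1^m\cdot\mathbf y$ subject to $M\mathbf y\le\mathbf a$, $\mathbf y\in\mathbb N^m$, and $\nu^*_{\mathbf a}(M)$ denotes the optimal value of its fractional relaxation, i.e. of maximizing $\mathbf 1^m\cdot\mathbf y$ subject to $M\mathbf y\le\mathbf a$, $\mathbf y\in\mathbb R^m_{\ge0}$.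
   Formalization: The matrix M is assumed to have at least one row and one column and no zero column; with a zero column both programs are unbounded and have no finite optimal value, and for m = 0 the claim would read 0 < 0. *)

(* Defs.v *)
From mathcomp Require Import all_boot all_order all_algebra.
From mathcomp Require Import all_classical all_reals ereal.

Set Implicit Arguments.
Unset Strict Implicit.
Unset Printing Implicit Defensive.

Import Order.TTheory GRing.Theory Num.Theory.

Local Open Scope classical_set_scope.
Local Open Scope ring_scope.

Definition int_feasible (n m : nat) (M : 'M[nat]_(n, m)) (a : 'cV[nat]_n) :
    set 'cV[nat]_m :=
  [set y : 'cV[nat]_m | forall i, ((M *m y)%R i ord0 <= a i ord0)%N].

Definition frac_feasible (R : realType) (n m : nat) (M : 'M[nat]_(n, m))
    (a : 'cV[nat]_n) : set 'cV[R]_m :=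
  [set y : 'cV[R]_m | (forall j, 0 <= y j ord0) /\
      (forall i, (map_mx (fun k : nat => k%:R : R) M *m y) i ord0
         <= (a i ord0)%:R)].

(* Optimal values are extended reals: both are +oo exactly when some column of
   M is zero; y = 0 is always feasible, so they are never -oo. *)

Definition nu (R : realType) (n m : nat) (M : 'M[nat]_(n, m))
    (a : 'cV[nat]_n) : \bar R :=
  ereal_sup [set ((\sum_(j < m) y j ord0)%N%:R)%:E | y in int_feasible M a].

Definition nu_frac (R : realType) (n m : nat) (M : 'M[nat]_(n, m))
    (a : 'cV[nat]_n) : \bar R :=
  ereal_sup [set (\sum_(j < m) y j ord0)%:E | y in @frac_feasible R n m M a].

(* Main.v *)
Require Import Defs.
From mathcomp Require Import all_boot all_order all_algebra.
From mathcomp Require Import all_classical all_reals ereal.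
From mathcomp Require Import lra.

Set Implicit Arguments.
Unset Strict Implicit.
Unset Printing Implicit Defensive.

(** A fractional solution whose support has more than [n] elements can be moved
along a kernel vector of [M] supported there, without decreasing the objective,
until a coordinate vanishes; so one may assume that the support has at most
[min m n] elements. Rounding down then loses less than 1 per coordinate of the
support. To get a gap that survives the supremum, let [N] be the sum of the
entries of [M] and [e = 1 / (N + 1)]: either some coordinate of the support has
fractional part at most [1 - e], and rounding down loses at most
[min m n - e], or rounding every coordinate of the support up adds less
than 1 to each constraint, hence keeps the integral solution feasible. *)

Import Order.TTheory GRing.Theory Num.Theory.

Local Open Scope ring_scope.

(** More than [n] columns of height [n] are linearly dependent; [d] is a dependency among the
    columns in [S], extended by zero. *)
Lemma exists_supported_kernel_vector (F : fieldType) (n m : nat)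
    (A : 'M[F]_(n, m)) (S : {set 'I_m}) :
  (n < #|S|)%N ->
  exists d : 'cV[F]_m,
    [/\ d != 0, A *m d = 0 & forall j, j \notin S -> d j ord0 = 0].
Proof.
move=> ltnS; pose f (k : 'I_#|S|) : 'I_m := enum_val k.
pose B := colsub f A.
have : kermx B^T != 0.
  by rewrite kermx_eq0 /row_free neq_ltn (leq_ltn_trans (rank_leq_col _)).
case/rowV0Pn => u /sub_kermxP uB u0.
(* Multiplying by [colsub f 1%:M] places entry [k] of [u] at position [f k] and zeros outside
   [S]. *)
have uE j : (colsub f 1%:M *m u^T) j ord0 = \sum_k (j == f k)%:R * u ord0 k.
  by rewrite mxE; apply: eq_bigr => k _; rewrite !mxE.
exists (colsub f 1%:M *m u^T); split.
- apply: contraNneq u0 => d0; apply/eqP/rowP => k; rewrite [RHS]mxE.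
  have := uE (f k); rewrite d0 mxE (bigD1 k) //= eqxx mul1r big1 ?addr0 => [<- //|].
  by move=> l lk; rewrite (inj_eq enum_val_inj) eq_sym (negbTE lk) mul0r.
- by rewrite mulmxA mulmx_colsub mulmx1 -/B -[B]trmxK -trmx_mul uB trmx0.
- move=> j jS; rewrite uE big1 // => k _.
  by case: eqP jS => [->|]; rewrite ?enum_valP ?mul0r.
Qed.

Section SparseSolution.

Variables (R : realFieldType) (n m : nat) (A : 'M[R]_(n, m)).
Hypothesis A_ge0 : forall i j, 0 <= A i j.
Hypothesis A_col_neq0 : forall j, col j A != 0.

Definition support (y : 'cV[R]_m) : {set 'I_m} := [set j | y j ord0 != 0].

(** If [d] were non-negative, each row of [A *m d] would be a vanishing sum of non-negative terms,
    and a nonzero entry in column [j] would force [d j ord0 = 0]. *)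
Lemma kernel_vector_neg (d : 'cV[R]_m) :
  d != 0 -> A *m d = 0 -> exists j, d j ord0 < 0.
Proof.
move=> d0 Ad; apply/existsP; apply: contraNT d0 => /existsPn dge0.
have {}dge0 j : 0 <= d j ord0 by rewrite leNgt dge0.
apply/eqP/colP => j; rewrite [RHS]mxE.
have [i Aij] : exists i, A i j != 0.
  apply/existsP; apply: contraNT (A_col_neq0 j) => /existsPn A0.
  by apply/eqP/colP => i; rewrite !mxE; apply/eqP; have := A0 i; rewrite negbK.
have /colP/(_ i) := Ad; rewrite !mxE => /psumr_eq0P.
move=> /(_ (fun k _ => mulr_ge0 (A_ge0 i k) (dge0 k)))/(_ j isT)/eqP.
by rewrite mulf_eq0 (negbTE Aij) => /eqP.
Qed.

Lemma shrink_support (y : 'cV[R]_m) :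
  (forall j, 0 <= y j ord0) -> (n < #|support y|)%N ->
  exists z : 'cV[R]_m, [/\ forall j, 0 <= z j ord0, A *m z = A *m y,
    \sum_j y j ord0 <= \sum_j z j ord0 & (#|support z| < #|support y|)%N].
Proof.
move=> y0 /(exists_supported_kernel_vector A)[d0 [d0_neq0 Ad0 d0S]].
(* Either [d0] or its opposite does not decrease the objective. *)
have [d [d_neq0 Ad dS d_sum]] : exists d : 'cV[R]_m,
    [/\ d != 0, A *m d = 0, forall j, j \notin support y -> d j ord0 = 0
      & 0 <= \sum_j d j ord0].
  have [s0|s0] := leP 0 (\sum_j d0 j ord0); first by exists d0.
  exists (- d0); split; rewrite ?oppr_eq0 // ?mulmxN ?Ad0 ?oppr0 //.
    by move=> j /d0S dj; rewrite mxE dj oppr0.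
  under eq_bigr do rewrite mxE.
  by rewrite sumrN oppr_ge0 ltW.
have [j0 dj0] := kernel_vector_neg d_neq0 Ad.
(* Ratio test: [t] is the largest step that keeps [y + t *: d] non-negative, and coordinate [j1]
   vanishes there. *)
case: (arg_minP (fun j => y j ord0 / - d j ord0)
  (P := [pred j | d j ord0 < 0]) dj0) => j1 /= dj1 tmin.
set t := y j1 ord0 / _ in tmin.
have t0 : 0 <= t by rewrite divr_ge0 ?oppr_ge0 ?(ltW dj1).
have zE j : (y + t *: d) j ord0 = y j ord0 + t * d j ord0 by rewrite !mxE.
exists (y + t *: d); split.
- move=> j; rewrite zE.
  have [dj|dj] := ltP (d j ord0) 0; last first.
    by apply: addr_ge0; [exact: y0 | exact: mulr_ge0].
  by have := tmin j dj; rewrite ler_pdivlMr ?oppr_gt0 // mulrN -subr_ge0 opprK.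
- by rewrite mulmxDr -scalemxAr Ad scaler0 addr0.
- under [leRHS]eq_bigr do rewrite zE.
  by rewrite big_split /= -mulr_sumr lerDl mulr_ge0.
- apply: proper_card; apply/fintype.properP; split.
    apply/fintype.subsetP => j; apply: contraTT => jS.
    move: (jS); rewrite !inE zE (dS _ jS) mulr0 addr0.
    by rewrite !negbK.
  exists j1; first by apply: contraTT dj1 => /dS ->; rewrite ltxx.
  by rewrite inE zE negbK /t invrN mulrN mulNr divfK ?subrr // lt_eqF.
Qed.

Lemma sparse_solution (y : 'cV[R]_m) :
  (forall j, 0 <= y j ord0) ->
  exists z : 'cV[R]_m, [/\ forall j, 0 <= z j ord0, A *m z = A *m y,
    \sum_j y j ord0 <= \sum_j z j ord0 & (#|support z| <= minn m n)%N].
Proof.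
have [s] := ubnP #|support y|; elim: s y => // s IHs y ys y0.
have [small|big] := leqP #|support y| n.
  by exists y; rewrite leq_min small -[X in (_ <= X)%N]card_ord max_card.
have [z [z0 Az yz zs]] := shrink_support y0 big.
have [w [w0 Aw zw ws]] := IHs z (leq_trans zs ys) z0.
by exists w; rewrite Aw (le_trans yz zw).
Qed.

End SparseSolution.

Lemma round_sparse_solution (R : realType) (n m k : nat) (M : 'M[nat]_(n, m))
    (a : 'cV[nat]_n) (y : 'cV[R]_m) :
  (0 < k)%N -> frac_feasible M a y -> (#|support y| <= k)%N ->
  exists2 z : 'cV[nat]_m, int_feasible M a z &
    \sum_j y j ord0 + (\sum_i \sum_j M i j)%N.+1%:R^-1
      <= (\sum_j z j ord0)%N%:R + k%:R.
Proof.
move=> k0 [y0 Mya] yk; set N := (\sum_i _)%N; set e : R := _^-1.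
have N1 : 0 < N.+1%:R :> R by rewrite ltr0n.
have e0 : 0 < e by rewrite invr_gt0.
have e1 : e <= 1 by rewrite invf_le1 // ler1n.
have Ne : N%:R * e < 1 by rewrite ltr_pdivrMr // mul1r ltr_nat.
have k1 : 1 <= k%:R :> R by rewrite ler1n.
pose S := support y.
have tr j : (Num.truncn (y j ord0))%:R <= y j ord0
            < (Num.truncn (y j ord0))%:R + 1.
  by rewrite natr1 truncn_itv.
have yS j : j \notin S -> y j ord0 = 0 by rewrite inE negbK => /eqP.
have [/existsP[j /andP[jS fj]]|/existsPn up] := boolP [exists j,
    (j \in S) && (y j ord0 - (Num.truncn (y j ord0))%:R <= 1 - e)].
- exists (\col_j Num.truncn (y j ord0)).
    move=> i; rewrite -(ler_nat R); apply: le_trans (Mya i).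
    rewrite !mxE natr_sum; apply: ler_sum => l _; rewrite !mxE natrM.
    by rewrite ler_wpM2l //; case/andP: (tr l).
  under [X in _ <= X%:R + _]eq_bigr do rewrite mxE.
  rewrite natr_sum; suff : \sum_l (y l ord0 - (Num.truncn (y l ord0))%:R)
      <= k%:R - e by rewrite sumrB; lra.
  rewrite (bigID (mem S)) /= [X in _ + X]big1 ?addr0; last first.
    by move=> l /yS ->; rewrite truncn0 subrr.
  rewrite (bigD1 j) //=.
  (* Coordinate [j] loses at most [1 - e], any other coordinate of [S] at most 1. *)
  have le1 : \sum_(l in S | l != j) (y l ord0 - (Num.truncn (y l ord0))%:R)
         <= \sum_(l in S | l != j) (1 : R).
    by apply: ler_sum => l _; have := tr l; lra.
  have : \sum_(l in S) (1 : R) <= k%:R by rewrite sumr_const ler_nat.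
  rewrite (bigD1 j) //=; lra.
(* All fractional parts on [S] exceed [1 - e], so rounding up adds less than [e] to each of these
   coordinates. *)
- pose w := \col_j (Num.truncn (y j ord0) + (j \in S))%N.
  have wl l : y l ord0 <= (w l ord0)%:R <= y l ord0 + e.
    rewrite mxE natrD; have := tr l; have := up l.
    case: (boolP (l \in S)) => [lS|/yS ->] /=; first by rewrite -ltNge; lra.
    by rewrite truncn0 => _ _; lra.
  exists w.
    (* By integrality it suffices to stay strictly below [a i ord0 + 1]; the excess is at most
       [N%:R * e < 1]. *)
    move=> i; rewrite -ltnS -(ltr_nat R) -natr1.
    have le2 : ((M *m w) i ord0)%:R <=
        \sum_l (M i l)%:R * y l ord0 + (\sum_l M i l)%N%:R * e.
      rewrite mxE !natr_sum mulr_suml -big_split /=; apply: ler_sum => l _.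
      by rewrite natrM -mulrDr ler_wpM2l //; case/andP: (wl l).
    have rowN : (\sum_l M i l <= N)%N.
      by rewrite /N (bigD1 i) //= leq_addr.
    have : (\sum_l M i l)%N%:R * e <= N%:R * e by rewrite ler_pM2r // ler_nat.
    have : \sum_l (M i l)%:R * y l ord0 <= (a i ord0)%:R.
      by have := Mya i; rewrite mxE; under eq_bigr do rewrite mxE.
    lra.
  (* Rounding up loses nothing, and [e <= 1 <= k%:R] covers the extra [e]. *)
  have : \sum_l y l ord0 <= (\sum_l w l ord0)%N%:R.
    by rewrite natr_sum; apply: ler_sum => l _; case/andP: (wl l).
  lra.
Qed.

(** A nonzero entry in column [j] is at least 1, so its row bounds [z j ord0]. This makes the
    integer optimum finite. *)
Lemma int_feasible_sum_le (n m : nat) (M : 'M[nat]_(n, m)) (a : 'cV[nat]_n)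
    (z : 'cV[nat]_m) :
  (forall j, col j M != 0) -> int_feasible M a z ->
  (\sum_j z j ord0 <= m * \sum_i a i ord0)%N.
Proof.
move=> M0 za; rewrite -[X in (_ <= X * _)%N]card_ord -sum_nat_const.
apply: leq_sum => j _.
have [i Mij] : exists i, M i j != 0%N.
  apply/existsP; apply: contraNT (M0 j) => /existsPn Mj0.
  by apply/eqP/colP => i; rewrite !mxE; apply/eqP; have := Mj0 i; rewrite negbK.
have ai : (a i ord0 <= \sum_i a i ord0)%N by rewrite (bigD1 i) //= leq_addr.
apply: leq_trans ai; apply: leq_trans (za i).
rewrite mxE (bigD1 j) //=; apply: leq_trans (leq_addr _ _).
by rewrite leq_pmull // lt0n.
Qed.

Theorem theorem4p1 (R : realType) (n m : nat) (M : 'M[nat]_(n, m))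
    (n_gt0 : (0 < n)%N) (m_gt0 : (0 < m)%N)
    (M_col_neq0 : forall j : 'I_m, col j M != 0)
    (a : 'cV[nat]_n) :
  (nu_frac R M a < nu R M a + (minn m n)%:R%:E)%E.
Proof.
have k_gt0 : (0 < minn m n)%N by rewrite leq_min m_gt0.
set k := minn m n in k_gt0 *.
have nu_ub (z : 'cV[nat]_m) : int_feasible M a z ->
    ((\sum_j z j ord0)%N%:R%:E <= nu R M a)%E.
  by move=> za; apply: ereal_sup_ubound; exists z.
(* The strict inequality would fail if [nu R M a] were infinite. *)
have nu_fin : nu R M a \is a fin_num.
  have nu_le : (nu R M a <= (m * \sum_i a i ord0)%N%:R%:E)%E.
    apply: ge_ereal_sup => _ [z za <-].
    by rewrite lee_fin ler_nat (int_feasible_sum_le M_col_neq0 za).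
  have /nu_ub nu_ge : int_feasible M a (0 : 'cV[nat]_m).
    by move=> i; rewrite mulmx0 mxE.
  rewrite fin_numE -ltNye -ltey (lt_le_trans _ nu_ge) ?ltNyr //.
  by rewrite (le_lt_trans nu_le) ?ltry.
move: nu_fin nu_ub => /fineK <-; set v := fine _ => nu_ub.
set e : R := (\sum_i \sum_j M i j)%N.+1%:R^-1.
have e0 : 0 < e by rewrite invr_gt0 ltr0n.
(* A supremum preserves only weak bounds; strictness comes from [e], which does not depend on
   [y]. *)
apply: (@le_lt_trans _ _ (v + k%:R - e)%:E); last by rewrite lte_fin; lra.
apply: ge_ereal_sup => _ [y [y0 Mya] <-]; rewrite lee_fin.
pose A : 'M[R]_(n, m) := map_mx (fun x : nat => x%:R) M.
have A0 i j : 0 <= A i j by rewrite mxE.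
have Acol j : col j A != 0.
  apply: contraNneq (M_col_neq0 j) => /colP Aj; apply/eqP/colP => i.
  by have /eqP := Aj i; rewrite !mxE pnatr_eq0 => /eqP.
have [z [z0 Az yz zk]] := sparse_solution A0 Acol y0.
have za : frac_feasible M a z by split=> // i; rewrite -/A Az.
have [w wa zw] := round_sparse_solution k_gt0 za zk.
by have := nu_ub w wa; rewrite lee_fin; move: zw; rewrite -/e; lra.
Qed.
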